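(* Let $\mathbb{E}[W^2]<\infty$ and fix an integer $q\ge3$. For $\beta>0$ and $B\ge0$, consider the solutions $s\in[0,1]$ of the stationarity condition $$\mathbb{E}\Big[\frac{W}{\mathbb{E}[W]}\,\frac{\mathrm{e}^{\beta'Ws+B}-1}{\mathrm{e}^{\beta'Ws+B}+q-1}\Big]=s,\qquad\beta'=\mathrm{e}^\beta-1.$$ (a) Let $B=0$, and assume that $\mathscr{F}_0$ satisfies the unique zero-crossing condition. Then there are $\beta_0\in(0,\infty)$ and $\beta_1\in(\beta_0,\infty)$ such that: for $\beta\in(0,\beta_0)$ only the trivial solution $s_1(\beta,0)=0$ exists; for $\beta\in(\beta_0,\beta_1)$ there are (exactly) three solutions $s_1(\beta,0)=0<s_2(\beta,0)<s_3(\beta,0)$; and for $\beta>\beta_1$ there are (exactly) two solutions $s_1(\beta,0)=0<s_3(\beta,0)$. (b) Let $B\in(0,\log(q-1))$, and assume that $\mathscr{F}_B$ satisfies the zero-crossing condition. Then there are $\beta_0(B)\in(0,\infty)$ and $\beta_1(B)\in(\beta_0(B),\infty)$ such that: for $\beta\in(0,\beta_0(B))$ there is a unique solution $s_1(\beta,B)>0$; for $\beta\in(\beta_0(B),\beta_1(B))$ there are (exactly) three solutions $0<s_1(\beta,B)<s_2(\beta,B)<s_3(\beta,B)$; and for $\beta>\beta_1(B)$ there is a unique solution $s_3(\beta,B)>0$.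
   Context: $W$ is a non-negative random variable with $\mathbb{E}[W]>0$ such that, for some $c>0$ and $\tau>2$, $\mathbb{P}(W>w)\le c\,w^{-(\tau-1)}$ for all $w\ge1$; it is the limiting weight of a rank-1 inhomogeneous random graph. For $B\ge0$ and $t\ge0$ define $$\mathscr{F}_B(t)=\mathbb{E}\Big[\frac{W}{\mathbb{E}[W]}\,\frac{\mathrm{e}^{tW+B}-1}{\mathrm{e}^{tW+B}+q-1}\Big].$$ Unique zero-crossing condition: $t\mapsto\frac{d^2}{dt^2}\mathscr{F}_B(t)$ is first positive and then negative, i.e. there is a (unique) inflection point $t_*(B)>0$ with $\frac{d^2}{dt^2}\mathscr{F}_B(t)>0$ for $0<t<t_*(B)$ and $\frac{d^2}{dt^2}\mathscr{F}_B(t)<0$ for $t>t_*(B)$. Zero-crossing condition: the unique zero-crossing condition holds and, in addition, the inflection point is steep: $\frac{d}{dt}\mathscr{F}_B(t_*(B))>\frac{\mathscr{F}_B(t_*(B))}{t_*(B)}$. *)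

(* Defs.v *)
From HB Require Import structures.
From mathcomp Require Import all_boot all_order all_algebra.
From mathcomp Require Import all_classical all_reals all_analysis.

Set Implicit Arguments.
Unset Strict Implicit.
Unset Printing Implicit Defensive.

Import Order.TTheory GRing.Theory Num.Theory.
Import numFieldNormedType.Exports.

Local Open Scope classical_set_scope.
Local Open Scope ring_scope.

(* For a non-negative integrable W with positive mean and 2 <= q, the integrand
   below is integrable for every t : R, so that [fine] is applied to a finite
   value. *)
Definition scrF (d : measure_display) (T : measurableType d) (R : realType)
    (P : probability T R) (W : T -> R) (q : nat) (B t : R) : R :=
  let EW : R := fine 'E_P[W]%E in
  fine 'E_P[(fun x =>
    W x / EW * ((expR (t * W x + B) - 1) / (expR (t * W x + B) + q%:R - 1)))%R]%E.

Definition inflection_pos_neg (R : realType) (f : R -> R) (tstar : R) : Prop :=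
  [/\ 0 < tstar,
      forall t : R, 0 < t -> t < tstar -> 0 < f^`(2)%classic t
    & forall t : R, tstar < t -> f^`(2)%classic t < 0].

Definition unique_zero_crossing (R : realType) (f : R -> R) : Prop :=
  exists! tstar : R, inflection_pos_neg f tstar.

Definition zero_crossing (R : realType) (f : R -> R) : Prop :=
  unique_zero_crossing f /\
  forall tstar : R, inflection_pos_neg f tstar ->
    f tstar / tstar < f^`()%classic tstar.

(* With beta' = expR beta - 1, the left-hand side of the stationarity condition
   E[W / E[W] * (e^(beta' W s + B) - 1) / (e^(beta' W s + B) + q - 1)] = s
   is scrF evaluated at t = beta' * s. *)
Definition stationary_points (d : measure_display) (T : measurableType d)
    (R : realType) (P : probability T R) (W : T -> R) (q : nat)
    (beta B : R) : set R :=
  [set s : R | 0 <= s <= 1 /\ scrF P W q B ((expR beta - 1) * s) = s].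

(* Main.v *)
(* Substituting t = (exp beta - 1) s, the positive stationary points correspond
   to the t > 0 with F(t) / t = 1 / (exp beta - 1).  The derivative of F(t) / t
   has the sign of the gap h(t) = t F'(t) - F(t), and h' = t F'', so h increases
   up to the inflection point a and decreases afterwards.  Since h(0) = - F(0)
   and h(a) > 0 (from h(0) = 0 when B = 0, by steepness when B > 0), while
   F <= 1 forces h to become negative eventually, F(t) / t increases from F'(0)
   then decreases to 0 when B = 0, and decreases from infinity, increases, then
   decreases to 0 when B > 0.  The thresholds are the values of beta for which
   1 / (exp beta - 1) is an extremal value of F(t) / t, or F'(0). *)

Require Import Defs.
From HB Require Import structures.
From mathcomp Require Import all_boot all_order all_algebra.
From mathcomp Require Import all_classical all_reals all_analysis.
From mathcomp Require Import measurable_realfun ring lra.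

Set Implicit Arguments.
Unset Strict Implicit.
Unset Printing Implicit Defensive.

Import Order.TTheory GRing.Theory Num.Theory.
Import numFieldNormedType.Exports.

Local Open Scope classical_set_scope.
Local Open Scope ring_scope.

(** * Level sets of [f t / t] *)

(* A divergent [lim] takes the junk value 0. *)
Lemma derive1_neq0_derivable (R : realType) (f : R -> R) (t : R) :
  f^`()%classic t != 0 -> derivable f t 1.
Proof.
apply: contra_neqP => ndf; rewrite derive1E.
exact: dvgP ndf.
Qed.

(** Minus the height at which the tangent to [f] at [t] meets the vertical axis; this is the [h] of
    the outline above. *)
Definition tangent_gap (R : realType) (f : R -> R) (t : R) : R :=
  t * f^`()%classic t - f t.

Section Ratio.
Variables (R : realType) (f : R -> R).
Hypothesis df : forall t, derivable f t 1.
Hypothesis cdf : continuous f^`()%classic.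

Local Notation gap := (tangent_gap f).
Local Notation ratio := (fun t => f t / t).

Lemma derivable_fun_continuous : continuous f.
Proof. by move=> t; apply/differentiable_continuous/derivable1_diffP. Qed.

Lemma tangent_gap_continuous : continuous gap.
Proof.
move=> t; apply: cvgB; last exact: derivable_fun_continuous.
by apply: cvgM; [exact: cvg_id|exact: cdf].
Qed.

Lemma is_derive_ratio (t : R) : 0 < t -> is_derive t 1 ratio (gap t / t ^+ 2).
Proof.
move=> t0; have tn0 : t != 0 by rewrite gt_eqF.
have dft : is_derive t 1 f (f^`()%classic t) by rewrite derive1E; exact: derivableP.
have -> : ratio = f * (fun x => x^-1) by [].
apply: is_derive_eq.
  apply: is_deriveM.
  exact: (@is_deriveV _ id t 1 1 tn0 (is_derive_id t 1)).
rewrite /gap /= /GRing.scale /=.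
by field.
Qed.

Lemma ratio_continuous_in (x y : R) : 0 < x -> {within `[x, y], continuous ratio}.
Proof.
move=> x0; apply: derivable_within_continuous => z; rewrite in_itv /= => /andP[xz _].
by have [] := is_derive_ratio (lt_le_trans x0 xz).
Qed.

Lemma ratio_MVT (x y : R) : 0 < x -> x < y ->
  exists t, [/\ x < t, t < y & ratio y - ratio x = gap t / t ^+ 2 * (y - x)].
Proof.
move=> x0 xy.
have dr z : z \in `]x, y[ -> is_derive z 1 ratio (gap z / z ^+ 2).
  by rewrite in_itv /= => /andP[xz _]; exact: is_derive_ratio (lt_trans x0 xz).
have [t] := MVT xy dr (ratio_continuous_in x0).
by rewrite in_itv /= => /andP[xt ty] e; exists t.
Qed.

Lemma ratio_increasing (x y : R) : 0 < x -> x < y ->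
  (forall t, x < t -> t < y -> 0 < gap t) -> ratio x < ratio y.
Proof.
move=> x0 xy gp; have [t [xt ty e]] := ratio_MVT x0 xy.
rewrite -subr_gt0 e mulr_gt0 ?subr_gt0// divr_gt0 ?gp//.
by rewrite exprn_gt0// (lt_trans x0).
Qed.

Lemma ratio_decreasing (x y : R) : 0 < x -> x < y ->
  (forall t, x < t -> t < y -> gap t < 0) -> ratio y < ratio x.
Proof.
move=> x0 xy gp; have [t [xt ty e]] := ratio_MVT x0 xy.
rewrite -subr_lt0 e pmulr_llt0 ?subr_gt0// pmulr_llt0 ?gp//.
by rewrite invr_gt0 exprn_gt0// (lt_trans x0).
Qed.

Lemma ratio_IVT (x y v : R) : 0 < x -> x < y ->
  (ratio x < v < ratio y) || (ratio y < v < ratio x) ->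
  exists2 t, x < t < y & ratio t = v.
Proof.
move=> x0 xy v_btw.
have [|t] := @IVT R ratio x y v (ltW xy) (ratio_continuous_in x0).
  by rewrite ge_min le_max /=; move: v_btw => /=; lra.
rewrite in_itv /= => /andP[xt ty] rt; exists t => //.
(* The strict inequalities on [v] exclude both endpoints. *)
rewrite !lt_neqAle xt ty !andbT; apply/andP; split.
  by apply/eqP => xE; move: v_btw; rewrite -rt -xE !ltxx andbF.
by apply/eqP => yE; move: v_btw; rewrite -rt -yE !ltxx !andbF.
Qed.

(** The terms in [f'] cancel in the derivative of the gap, leaving [t f''(t)]. Differentiability of
    [f'] comes from the nonvanishing hypothesis, a divergent limit having value 0. *)
Lemma tangent_gap_MVT (x y : R) : x < y ->
  (forall t, x < t -> t < y -> f^`(2)%classic t != 0) ->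
  exists t, [/\ x < t, t < y & gap y - gap x = t * f^`(2)%classic t * (y - x)].
Proof.
move=> xy ddf.
have dg z : z \in `]x, y[ -> is_derive z 1 gap (z * f^`(2)%classic z).
  rewrite in_itv /= => /andP[xz zy].
  have dfz : is_derive z 1 f (f^`()%classic z) by rewrite derive1E; exact: derivableP.
  have ddfz : is_derive z 1 f^`()%classic (f^`(2)%classic z).
    rewrite [X in is_derive _ _ _ X](derive1E f^`()%classic); apply: derivableP.
    by apply: derive1_neq0_derivable; exact: ddf.
  have -> : gap = id * f^`()%classic - f by [].
  apply: is_derive_eq; rewrite /GRing.scale /=; ring.
have [|t] := MVT xy dg.
  by apply: continuous_subspaceT; exact: tangent_gap_continuous.
by rewrite in_itv /= => /andP[xt ty] e; exists t.
Qed.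

Lemma derive1_increasing (x y : R) : x < y ->
  (forall t, x < t -> t < y -> 0 < f^`(2)%classic t) -> f^`()%classic x < f^`()%classic y.
Proof.
move=> xy ddf.
have ddfz z : z \in `]x, y[ -> is_derive z 1 f^`()%classic (f^`(2)%classic z).
  rewrite in_itv /= => /andP[xz zy].
  rewrite [X in is_derive _ _ _ X](derive1E f^`()%classic); apply: derivableP.
  by apply: derive1_neq0_derivable; rewrite gt_eqF//; exact: ddf.
have [|t] := MVT xy ddfz; first exact: continuous_subspaceT.
rewrite in_itv /= => /andP[xt ty] e.
by rewrite -subr_gt0 e mulr_gt0 ?subr_gt0// ddf.
Qed.

(** * Shape of the gap around an inflection point *)

Section Inflection.
Variable ts : R.
Hypothesis infl : inflection_pos_neg f ts.

Lemma inflection_gt0 : 0 < ts. Proof. by case: infl. Qed.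

Lemma tangent_gap_increasing (x y : R) :
  0 <= x -> x < y -> y <= ts -> gap x < gap y.
Proof.
case: infl => _ ddf _ x0 xy yts.
have ddf0 t : x < t -> t < y -> 0 < f^`(2)%classic t.
  by move=> xt ty; apply: ddf; [exact: le_lt_trans xt|exact: lt_le_trans yts].
have [|t [xt ty e]] := tangent_gap_MVT xy.
  by move=> t xt ty; rewrite gt_eqF// ddf0.
rewrite -subr_gt0 e mulr_gt0 ?subr_gt0// mulr_gt0 ?ddf0//.
exact: le_lt_trans xt.
Qed.

Lemma tangent_gap_decreasing (x y : R) : ts <= x -> x < y -> gap y < gap x.
Proof.
case: infl => ts0 _ ddf tsx xy.
have ddf0 t : x < t -> t < y -> f^`(2)%classic t < 0.
  by move=> xt ty; apply: ddf; exact: le_lt_trans xt.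
have [|t [xt ty e]] := tangent_gap_MVT xy.
  by move=> t xt ty; rewrite lt_eqF// ddf0.
rewrite -subr_lt0 e pmulr_llt0 ?subr_gt0// pmulr_rlt0 ?ddf0//.
exact: lt_trans ts0 (le_lt_trans tsx xt).
Qed.

Hypothesis f_le1 : forall t, 0 <= t -> f t <= 1.

Lemma ratio_small (M v : R) : 0 <= M -> 0 < v -> exists2 t, M < t & ratio t < v.
Proof.
(* The witness exceeds [M], and [v] times it is larger than 1, the bound on [f]. *)
move=> M0 v0; exists (M + 1 + v^-1).
  by rewrite -addrA ltrDl addr_gt0 ?invr_gt0.
have vi : 0 < v^-1 by rewrite invr_gt0.
have t0 : 0 < M + 1 + v^-1 by lra.
rewrite ltr_pdivrMr//; apply: le_lt_trans (f_le1 (ltW t0)) _.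
by rewrite !mulrDr mulfV ?gt_eqF// mulr1; have := mulr_ge0 (ltW v0) M0; lra.
Qed.

Hypothesis steep : 0 < gap ts.
Hypothesis fts_gt0 : 0 < f ts.

(** A gap positive on all of [(ts, oo)] would make [f t / t] increase from [f ts / ts > 0], whereas
    [f <= 1] makes it arbitrarily small. So the gap reaches 0 beyond [ts], and its strict decrease
    there gives the signs. *)
Lemma tangent_gap_zero : exists b, [/\ ts < b, gap b = 0,
  forall t, ts <= t -> t < b -> 0 < gap t & forall t, b < t -> gap t < 0].
Proof.
have ts0 := inflection_gt0.
have [c tsc gc] : exists2 c, ts < c & gap c <= 0.
  apply: contrapT => /forall2NP gpos.
  have [t tst] := ratio_small (ltW ts0) (divr_gt0 fts_gt0 ts0).
  apply/negP; rewrite -leNgt ltW//; apply: ratio_increasing => // u tsu _.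
  by have [//|/negP] := gpos u; rewrite -ltNge.
have [||b] := @IVT R gap ts c 0 (ltW tsc).
- exact/continuous_subspaceT/tangent_gap_continuous.
- by rewrite ge_min le_max gc (ltW steep) orbT.
rewrite in_itv /= => /andP[tsb bc] gb.
have {}tsb : ts < b.
  by rewrite lt_neqAle tsb andbT; apply/eqP => tE; move: steep; rewrite tE gb ltxx.
exists b; split => // t.
  by move=> tst tb; rewrite -gb tangent_gap_decreasing.
by move=> bt; rewrite -[ltRHS]gb tangent_gap_decreasing// ltW.
Qed.

End Inflection.

Lemma ratio_large (a v : R) : 0 < f 0 -> (forall t, 0 <= t -> f 0 <= f t) ->
  0 < a -> 0 < v -> exists2 x, 0 < x < a & v < ratio x.
Proof.
(* Since [f x >= f 0], the second bound makes the ratio at least [2 v]; the first keeps [x] below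
   [a]. *)
move=> f0 f0_le a0 v0; pose x := Num.min (a / 2) (f 0 / (v * 2)).
have x0 : 0 < x by rewrite lt_min !divr_gt0 ?mulr_gt0.
have xa : x <= a / 2 by rewrite ge_min lexx.
have xv : x <= f 0 / (v * 2) by rewrite ge_min lexx orbT.
exists x; first by lra.
rewrite ltr_pdivlMr//; apply: lt_le_trans (f0_le x (ltW x0)).
move: xv; rewrite ler_pdivlMr ?mulr_gt0// => xv; lra.
Qed.

(** * Counting solutions of [f t / t = v] branch by branch *)

Section Branches.
Variable b : R.
Hypothesis b_gt0 : 0 < b.
Hypothesis f_le1 : forall t, 0 <= t -> f t <= 1.
Hypothesis dec_b : forall x y, b <= x -> x < y -> ratio y < ratio x.

(** The ratio falls below every positive level because [f <= 1], and strict decrease makes the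
    crossing unique. *)
Lemma last_branch (v : R) : 0 < v -> v < ratio b ->
  exists2 t, b < t & ratio t = v /\ forall u, b <= u -> ratio u = v -> u = t.
Proof.
move=> v0 vb; have [y by_ yv] := ratio_small f_le1 (ltW b_gt0) v0.
have [|t /andP[bt ty] rt] := @ratio_IVT b y v b_gt0 by_; first by rewrite yv vb orbT.
exists t => //; split => // u bu ru; have [ut|tu|//] := ltgtP u t.
  by have := dec_b bu ut; rewrite rt ru ltxx.
by have := dec_b (ltW bt) tu; rewrite rt ru ltxx.
Qed.

(** [r0] stands for the right limit of the ratio at 0, given as an infimum that is not attained: the
    ratio at 0 itself is a division by zero. The ratio rises from [r0] on [(0, b]] and falls on
    [[b, oo)], so a level in between is met once on each branch, and a positive level below [r0]
    only on the falling one. *)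
Lemma two_branches (r0 v : R) :
  (forall x y, 0 < x -> x < y -> y <= b -> ratio x < ratio y) ->
  (forall x, 0 < x -> x <= b -> r0 < ratio x) ->
  (forall w, r0 < w -> exists2 x, 0 < x < b & ratio x < w) ->
  0 < v ->
  [/\ ratio b < v -> forall t, 0 < t -> ratio t <> v,
      r0 < v < ratio b -> exists t2 t3, [/\ 0 < t2, t2 < t3 &
        forall t, 0 < t -> ratio t = v <-> t = t2 \/ t = t3]
    & v < r0 -> exists2 t3, 0 < t3 & forall t, 0 < t -> ratio t = v <-> t = t3].
Proof.
move=> inc r0_lt r0_lim v0; split.
- move=> bv t t0 rt; have [tb|bt|tb] := ltgtP t b.
  + by have := inc _ _ t0 tb (lexx _); lra.
  + by have := dec_b (lexx _) bt; lra.
  + by move: rt bv; rewrite tb => ->; rewrite ltxx.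
- move=> /andP[r0v vb].
  have [t3 bt3 [rt3 uniq3]] := last_branch v0 vb.
  have [x /andP[x0 xb] xv] := r0_lim _ r0v.
  have [|t2 /andP[xt2 t2b] rt2] := @ratio_IVT x b v x0 xb; first by rewrite xv vb.
  have t20 := lt_trans x0 xt2.
  exists t2, t3; split => //; first exact: lt_trans bt3.
  move=> t t0; split=> [rt|[]->//].
  have [bt|tb] := leP b t; first by right; apply: uniq3.
  left; have [tt2|t2t|//] := ltgtP t t2.
    by have := inc _ _ t0 tt2 (ltW t2b); rewrite rt rt2 ltxx.
  by have := inc _ _ t20 t2t (ltW tb); rewrite rt rt2 ltxx.
- move=> vr0.
  have [t3 bt3 [rt3 uniq3]] := last_branch v0 (lt_trans vr0 (r0_lt _ b_gt0 (lexx _))).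
  exists t3; first exact: lt_trans bt3.
  move=> t t0; split=> [rt|->//].
  have [bt|tb] := leP b t; first exact: uniq3.
  by have := r0_lt _ t0 (ltW tb); rewrite rt => /(lt_trans vr0); rewrite ltxx.
Qed.

(** The branches are a fall from infinity on [(0, a]], a rise on [[a, b]] and a fall to 0 on
    [[b, oo)]. Levels above [ratio b] meet only the first, positive levels below [ratio a] only the
    last. *)
Lemma three_branches (a v : R) :
  0 < a -> a < b ->
  (forall x y, 0 < x -> x < y -> y <= a -> ratio y < ratio x) ->
  (forall x y, a <= x -> x < y -> y <= b -> ratio x < ratio y) ->
  (forall w, 0 < w -> exists2 x, 0 < x < a & w < ratio x) ->
  0 < v ->
  [/\ ratio b < v -> exists2 t1, 0 < t1 & forall t, 0 < t -> ratio t = v <-> t = t1,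
      ratio a < v < ratio b -> exists t1 t2 t3, [/\ 0 < t1, t1 < t2, t2 < t3 &
        forall t, 0 < t -> ratio t = v <-> [\/ t = t1, t = t2 | t = t3]]
    & v < ratio a -> exists2 t3, 0 < t3 & forall t, 0 < t -> ratio t = v <-> t = t3].
Proof.
move=> a0 ab dec inc r_lim v0.
have rab := inc _ _ (lexx a) ab (lexx b).
(* Counterpart of [last_branch] at the left end, with unboundedness near 0 in place of smallness at
   infinity. *)
have first_branch : ratio a < v -> exists2 t, 0 < t < a &
    ratio t = v /\ forall u, 0 < u -> u <= a -> ratio u = v -> u = t.
  move=> av; have [x /andP[x0 xa] vx] := r_lim _ v0.
  have [|t /andP[xt ta] rt] := @ratio_IVT x a v x0 xa; first by rewrite av vx orbT.
  have t0 := lt_trans x0 xt.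
  exists t; rewrite ?t0//; split => // u u0 ua ru; have [ut|tu|//] := ltgtP u t.
    by have := dec _ _ u0 ut (ltW ta); rewrite rt ru ltxx.
  by have := dec _ _ t0 tu ua; rewrite rt ru ltxx.
split.
- move=> bv; have [t1 /andP[t10 t1a] [rt1 uniq1]] := first_branch (lt_trans rab bv).
  exists t1 => // t t0; split=> [rt|->//].
  have [ta|at_] := leP t a; first exact: uniq1.
  exfalso; have [tb|bt|tb] := ltgtP t b.
  + by have := inc _ _ (ltW at_) tb (lexx _); lra.
  + by have := dec_b (lexx _) bt; lra.
  + by move: rt bv; rewrite tb => ->; rewrite ltxx.
- move=> /andP[av vb].
  have [t1 /andP[t10 t1a] [rt1 uniq1]] := first_branch av.
  have [t3 bt3 [rt3 uniq3]] := last_branch v0 vb.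
  have [|t2 /andP[at2 t2b] rt2] := @ratio_IVT a b v a0 ab; first by rewrite av vb.
  exists t1, t2, t3; split => //; [exact: lt_trans at2|exact: lt_trans bt3|].
  move=> t t0; split=> [rt|[]->//].
  have [ta|at_] := leP t a; first by constructor 1; exact: uniq1.
  have [bt|tb] := leP b t; first by constructor 3; exact: uniq3.
  constructor 2; have [tt2|t2t|//] := ltgtP t t2.
    by have := inc _ _ (ltW at_) tt2 (ltW t2b); rewrite rt rt2 ltxx.
  by have := inc _ _ (ltW at2) t2t (ltW tb); rewrite rt rt2 ltxx.
- move=> va.
  have [t3 bt3 [rt3 uniq3]] := last_branch v0 (lt_trans va rab).
  exists t3; first exact: lt_trans bt3.
  move=> t t0; split=> [rt|->//].
  have [bt|tb] := leP b t; first exact: uniq3.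
  exfalso; have [ta|at_|ta] := ltgtP t a.
  + by have := dec _ _ t0 ta (lexx _); lra.
  + by have := inc _ _ (lexx _) at_ (ltW tb); lra.
  + by move: rt va; rewrite ta => ->; rewrite ltxx.
Qed.

End Branches.

(** Here [r0] is [f'(0)] and [rb] is the maximum of the ratio, reached at the zero of the gap past
    the inflection point. *)
Lemma level_sets_vanishing_at0 : f 0 = 0 -> 0 < f^`()%classic 0 ->
  (forall t, 0 <= t -> f t <= 1) -> (exists ts, inflection_pos_neg f ts) ->
  exists r0 rb, 0 < r0 < rb /\ forall v, 0 < v ->
  [/\ rb < v -> forall t, 0 < t -> ratio t <> v,
      r0 < v < rb -> exists t2 t3, [/\ 0 < t2, t2 < t3 &
        forall t, 0 < t -> ratio t = v <-> t = t2 \/ t = t3]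
    & v < r0 -> exists2 t3, 0 < t3 & forall t, 0 < t -> ratio t = v <-> t = t3].
Proof.
move=> f0 df0 f_le1 [ts infl]; have ts0 := inflection_gt0 infl.
have gap0 : gap 0 = 0 by rewrite /tangent_gap f0 mul0r subr0.
have gap_pos t : 0 < t -> t <= ts -> 0 < gap t.
  by move=> t0 tts; rewrite -gap0; exact: (tangent_gap_increasing infl).
(* As [f 0 = 0], the ratio is the slope of a chord from the origin, hence a value of [f']. This
   yields both the bound [f'(0) < ratio x] up to [ts], where [f'] increases, and the limit [f'(0)]
   at 0, where [f'] is continuous. *)
have chord x : 0 < x -> exists2 t, 0 < t < x & ratio x = f^`()%classic t.
  move=> x0.
  have dfz z : z \in `]0, x[ -> is_derive z 1 f (f^`()%classic z).
    by move=> _; rewrite derive1E; exact: derivableP.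
  have [|t] := MVT x0 dfz.
    by apply: continuous_subspaceT; exact: derivable_fun_continuous.
  rewrite in_itv /= f0 !subr0 => tx ->.
  by exists t; rewrite ?mulfK ?gt_eqF.
have df_gt t : 0 < t -> t <= ts -> f^`()%classic 0 < f^`()%classic t.
  case: infl => _ ddf _ t0 tts; apply: derive1_increasing => // u u0 ut.
  by apply: ddf => //; exact: lt_le_trans tts.
have ratio_gt x : 0 < x -> x <= ts -> f^`()%classic 0 < ratio x.
  move=> x0 xts; have [t /andP[t0 tx] ->] := chord x x0.
  by apply: df_gt => //; exact: le_trans (ltW tx) xts.
have rts := ratio_gt _ ts0 (lexx _).
have fts : 0 < f ts by have := lt_trans df0 rts; rewrite pmulr_lgt0 ?invr_gt0.
have [b [tsb _ gap_pos' gap_neg]] :=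
  tangent_gap_zero infl f_le1 (gap_pos _ ts0 (lexx _)) fts.
have b0 := lt_trans ts0 tsb.
have inc x y : 0 < x -> x < y -> y <= b -> ratio x < ratio y.
  move=> x0 xy yb; apply: ratio_increasing => // t xt ty.
  have [tst|/ltW tts] := leP ts t; first exact: gap_pos' (lt_le_trans ty yb).
  by apply: gap_pos tts; exact: lt_trans xt.
have dec x y : b <= x -> x < y -> ratio y < ratio x.
  move=> bx xy; apply: ratio_decreasing => //; first exact: lt_le_trans bx.
  by move=> t xt _; apply: gap_neg; exact: le_lt_trans xt.
have r0_lt x : 0 < x -> x <= b -> f^`()%classic 0 < ratio x.
  move=> x0 xb; have [xts|tsx] := leP x ts; first exact: ratio_gt.
  exact: lt_trans rts (inc _ _ ts0 tsx xb).
exists (f^`()%classic 0), (ratio b); split; first by rewrite df0 r0_lt.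
move=> v v0; apply: two_branches => //.
move=> w w_gt.
have /nbhs_ballP[e /= e0 He] : \forall t \near (0 : R), f^`()%classic t < w.
  exact: (cvgr_lt _ (@cdf 0)).
(* The bound [e / 2] puts the mean-value point [t < x] in the ball where [f' < w], and [ts / 2]
   keeps [x] below [b]. *)
pose x := Num.min (e / 2) (ts / 2).
have x0 : 0 < x by rewrite lt_min !divr_gt0.
have xe : x <= e / 2 by rewrite ge_min lexx.
have xts : x <= ts / 2 by rewrite ge_min lexx orbT.
exists x; first by lra.
have [t /andP[t0 tx] ->] := chord x x0.
by apply: He; rewrite /ball /= sub0r normrN gtr0_norm//; lra.
Qed.

(** The gap is [- f 0 < 0] at 0 and positive at [ts] by steepness, so it has a zero [a] before [ts]
    besides the zero [b] after it. The levels [ra] and [rb] are the local minimum and maximum of the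
    ratio, at [a] and [b]. *)
Lemma level_sets_positive_at0 : 0 < f 0 -> (forall t, 0 <= t -> f 0 <= f t) ->
  (forall t, 0 <= t -> f t <= 1) ->
  (exists2 ts, inflection_pos_neg f ts & f ts / ts < f^`()%classic ts) ->
  exists ra rb, 0 < ra < rb /\ forall v, 0 < v ->
  [/\ rb < v -> exists2 t1, 0 < t1 & forall t, 0 < t -> ratio t = v <-> t = t1,
      ra < v < rb -> exists t1 t2 t3, [/\ 0 < t1, t1 < t2, t2 < t3 &
        forall t, 0 < t -> ratio t = v <-> [\/ t = t1, t = t2 | t = t3]]
    & v < ra -> exists2 t3, 0 < t3 & forall t, 0 < t -> ratio t = v <-> t = t3].
Proof.
move=> f0 f0_le f_le1 [ts infl]; have ts0 := inflection_gt0 infl.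
rewrite ltr_pdivrMr// mulrC -subr_gt0 => gap_ts; have steep : 0 < gap ts := gap_ts.
have f_gt0 t : 0 <= t -> 0 < f t by move=> t0; exact: lt_le_trans (f0_le _ t0).
have [b [tsb _ gap_pos gap_neg]] :=
  tangent_gap_zero infl f_le1 steep (f_gt0 _ (ltW ts0)).
have b0 := lt_trans ts0 tsb.
have gap0 : gap 0 < 0 by rewrite /tangent_gap mul0r sub0r oppr_lt0.
have [||a] := @IVT R gap 0 ts 0 (ltW ts0).
- exact/continuous_subspaceT/tangent_gap_continuous.
- by rewrite ge_min le_max (ltW gap0) (ltW steep) orbT.
rewrite in_itv /= => /andP[a0 ats] gapa.
have {}a0 : 0 < a.
  by rewrite lt_neqAle a0 andbT; apply/eqP => aE; move: gap0; rewrite [X in gap X]aE gapa ltxx.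
have {}ats : a < ts.
  rewrite lt_neqAle ats andbT; apply/eqP => aE.
  move: steep; rewrite -aE gapa. by rewrite ltxx.
have ab := lt_trans ats tsb.
have inc x y : a <= x -> x < y -> y <= b -> ratio x < ratio y.
  move=> ax xy yb; apply: ratio_increasing => //; first exact: lt_le_trans ax.
  move=> t xt ty.
  (* Beyond [ts] the sign comes from the choice of [b]; before [ts] the gap grows from its zero at
     [a]. *)
  have [tst|/ltW tts] := leP ts t; first exact: gap_pos (lt_le_trans ty yb).
  by rewrite -gapa; apply: (tangent_gap_increasing infl (ltW a0)); rewrite ?(le_lt_trans ax).
have dec_a x y : 0 < x -> x < y -> y <= a -> ratio y < ratio x.
  move=> x0 xy ya; apply: ratio_decreasing => // t xt ty.
  rewrite -[ltRHS]gapa; apply: (tangent_gap_increasing infl).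
  - by apply: ltW; exact: lt_trans xt.
  - exact: lt_le_trans ya.
  - exact: ltW.
have dec_b x y : b <= x -> x < y -> ratio y < ratio x.
  move=> bx xy; apply: ratio_decreasing => //; first exact: lt_le_trans bx.
  by move=> t xt _; apply: gap_neg; exact: le_lt_trans xt.
exists (ratio a), (ratio b); split.
  by rewrite inc// andbT divr_gt0// f_gt0// ltW.
move=> v v0; apply: three_branches => // w w0.
exact: ratio_large.
Qed.

End Ratio.

(** * The mean-field function *)

(** With [k = q - 1] and [y = t W + B] this is the fraction inside [scrF]. *)
Definition sigm (R : realType) (k y : R) : R := (expR y - 1) / (expR y + k).

Definition dsigm (R : realType) (k y : R) : R :=
  (k + 1) * expR y / (expR y + k) ^+ 2.

(** * Bounds and derivative of the kernel *)

Section Sigm.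
Variables (R : realType) (k : R).
Hypothesis k_ge1 : 1 <= k.

Let den_gt0 (y : R) : 0 < expR y + k.
Proof. by move: k_ge1 (expR y) (expR_gt0 y) => k1 e e0; lra. Qed.

Lemma is_derive_sigm (y : R) : is_derive y 1 (sigm k) (dsigm k y).
Proof.
have dn0 : expR y + k != 0 by rewrite gt_eqF.
have dd c : is_derive y 1 (fun z => expR z + c) (expR y).
  have -> : (fun z => expR z + c) = expR + cst c by [].
  by apply: is_derive_eq; rewrite addr0.
have -> : sigm k = (fun z => expR z - 1) * (fun z => (expR z + k)^-1) by [].
have dV := @is_deriveV _ (fun z => expR z + k) y _ 1 dn0 (dd k).
apply: (is_derive_eq (is_deriveM (dd (- 1)) dV)).
rewrite /dsigm /GRing.scale /=.
by field.
Qed.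

Lemma sigm_continuous : continuous (sigm k).
Proof.
move=> y; apply/differentiable_continuous/derivable1_diffP.
by have [] := is_derive_sigm y.
Qed.

Lemma dsigm_continuous : continuous (dsigm k).
Proof.
move=> y; rewrite /dsigm; apply: cvgM.
  by apply: cvgM; [exact: cvg_cst|exact: continuous_expR].
apply: cvgV; first by rewrite expf_neq0// gt_eqF.
rewrite expr2; under eq_fun do rewrite expr2.
by apply: cvgM; (apply: cvgD; [exact: continuous_expR|exact: cvg_cst]).
Qed.

Lemma dsigm_gt0 (y : R) : 0 < dsigm k y.
Proof.
apply: divr_gt0; last exact: exprn_gt0.
by apply: mulr_gt0; [move: k_ge1; lra|exact: expR_gt0].
Qed.

Lemma dsigm_le1 (y : R) : dsigm k y <= 1.
Proof.
rewrite /dsigm ler_pdivrMr ?exprn_gt0// mul1r.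
(* Expanded, the claim is [0 <= e^2 + (k - 1) e + k^2], where no term is negative as [k >= 1]. *)
move: (expR y) (expR_gt0 y) => e e0; move: k_ge1.
nra.
Qed.

Lemma sigm_le1 (y : R) : sigm k y <= 1.
Proof.
rewrite /sigm ler_pdivrMr// mul1r lerD2l.
by move: k_ge1; lra.
Qed.

Lemma sigm_norm_le1 (y : R) : `|sigm k y| <= 1.
Proof.
rewrite ler_norml sigm_le1 andbT /sigm ler_pdivlMr//.
by move: (expR y) (expR_gt0 y) => e e0; move: k_ge1; lra.
Qed.

Lemma sigm_nondecreasing : {homo sigm k : x y / x <= y}.
Proof.
move=> x y xy; rewrite /sigm ler_pdivrMr// mulrAC ler_pdivlMr//.
(* After cross-multiplication the two sides differ by [(k + 1) (expR y - expR x)]. *)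
have : expR x <= expR y by rewrite ler_expR.
move: (expR x) (expR y) (expR_gt0 x) => a b a0 ab; move: k_ge1.
nra.
Qed.

Lemma sigm0 : sigm k 0 = 0.
Proof. by rewrite /sigm expR0 subrr mul0r. Qed.

Lemma sigm_gt0 (y : R) : 0 < y -> 0 < sigm k y.
Proof. by move=> y0; rewrite /sigm divr_gt0// subr_gt0 expR_gt1. Qed.

End Sigm.

(** * Integrability and moments of the weight *)

Section Moments.
Context (d : measure_display) (T : measurableType d) (R : realType).
Variables (P : probability T R) (W : {RV P >-> R}).
Hypothesis W_ge0 : forall x : T, 0 <= W x.
Hypothesis EW_gt0 : (0 < 'E_P[W])%E.
Hypothesis EW2_fin : ('E_P[fun x => (W x ^+ 2)%R] < +oo)%E.

Lemma integrable_sqr : P.-integrable setT (EFin \o (fun x => W x ^+ 2)).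
Proof.
apply/integrableP; split; first by apply/measurable_EFinP; exact: measurable_funX.
move: EW2_fin; rewrite unlock; apply: le_lt_trans.
by rewrite le_eqVlt; apply/orP; left; apply/eqP; apply: eq_integral => x _ /=;
  rewrite ger0_norm ?sqr_ge0.
Qed.

(** Domination by the square, as [w <= w^2 + 1]. *)
Lemma integrable_weight : P.-integrable setT (EFin \o W).
Proof.
apply: (@le_integrable _ _ _ P setT measurableT _
  (EFin \o (fun x => W x ^+ 2 + cst 1 x))).
- exact/measurable_EFinP.
- move=> x _ /=; rewrite lee_fin ger0_norm// ger0_norm ?addr_ge0 ?sqr_ge0//.
  by move: (W x) (W_ge0 x) => w w0; nra.
- have -> : EFin \o (fun x => W x ^+ 2 + cst 1 x) =
    (EFin \o (fun x => W x ^+ 2)) \+ (EFin \o cst 1) by [].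
  apply: integrableD => //; first exact: integrable_sqr.
  exact: finite_measure_integrable_cst.
Qed.

Local Notation m := (fine 'E_P[W]%E).

Lemma fine_expectation (X : T -> R) :
  fine 'E_P[X]%E = \int[P]_x X x.
Proof. by rewrite unlock. Qed.

Lemma mean_gt0 : 0 < m.
Proof.
apply: fine_gt0; rewrite EW_gt0 /=.
rewrite unlock; apply: integrable_lty => //; exact: integrable_weight.
Qed.

(** Integrating [(W - m)^2 >= 0] gives [2 m^2 <= E[W^2] + m^2], hence [E[W^2] >= m^2 > 0]. *)
Lemma second_moment_gt0 : 0 < \int[P]_x (W x ^+ 2).
Proof.
move: mean_gt0 (fine_expectation W); move: m => mu mu0 muE.
suff : mu * (2 * mu) <= \int[P]_x (W x ^+ 2) + mu ^+ 2 by nra.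
have PT1 : fine (P setT) = 1 by rewrite probability_setT.
have -> : \int[P]_x (W x ^+ 2) + mu ^+ 2 = \int[P]_x (W x ^+ 2 + mu ^+ 2).
  rewrite RintegralD//; [|exact: integrable_sqr|exact: finite_measure_integrable_cst].
  by rewrite Rintegral_cst// PT1 mulr1.
rewrite {1}muE -RintegralZr//; last exact: integrable_weight.
apply: le_Rintegral => //.
- have := integrableZr measurableT (2 * mu) integrable_weight.
  by apply: eq_integrable.
- have -> : EFin \o (fun x => W x ^+ 2 + mu ^+ 2) =
    (EFin \o (fun x => W x ^+ 2)) \+ (EFin \o cst (mu ^+ 2)) by [].
  apply: integrableD => //; first exact: integrable_sqr.
  exact: finite_measure_integrable_cst.
- by move=> x _; have := sqr_ge0 (W x - mu); move: (W x) => w; nra.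
Qed.

End Moments.

(** * Bounds and smoothness of [scrF], and its link with stationary points *)

Section MeanField.
Context (d : measure_display) (T : measurableType d) (R : realType).
Variables (P : probability T R) (W : {RV P >-> R}) (q : nat) (B : R).
Hypothesis W_ge0 : forall x : T, 0 <= W x.
Hypothesis EW_gt0 : (0 < 'E_P[W])%E.
Hypothesis EW2_fin : ('E_P[fun x => (W x ^+ 2)%R] < +oo)%E.
Hypothesis q_ge2 : (2 <= q)%N.

Local Notation m := (fine 'E_P[W]%E).
Local Notation k := (q%:R - 1 : R).
Local Notation F := (scrF P W q B).

Let k_ge1 : 1 <= k.
Proof. by rewrite lerBrDr -[1 + 1]/(2%:R) ler_nat. Qed.

Let m_gt0 : 0 < m := mean_gt0 W_ge0 EW_gt0 EW2_fin.

Lemma scrF_Rintegral (t : R) :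
  F t = \int[P]_x (W x / m * sigm k (t * W x + B)).
Proof.
rewrite /scrF fine_expectation; apply: eq_Rintegral => x _.
by rewrite /sigm addrA.
Qed.

(** [X] is left free because it is taken as [W] for [scrF] and as [W^2] for its derivative. *)
Lemma integrable_bounded_mul (X h : T -> R) :
  P.-integrable setT (EFin \o X) -> measurable_fun setT h ->
  (forall x, `|h x| <= 1) -> P.-integrable setT (EFin \o (fun x => X x / m * h x)).
Proof.
move=> iX mh h1.
have iXm : P.-integrable setT (EFin \o (fun x => X x / m)).
  by have := integrableZr measurableT m^-1 iX; apply: eq_integrable.
apply: le_integrable iXm => //.
- have mX : measurable_fun setT X by apply/measurable_EFinP; exact: measurable_int iX.
  by apply/measurable_EFinP; apply: measurable_funM => //; exact: measurable_funM.
- by move=> x _ /=; rewrite lee_fin normrM ler_piMr.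
Qed.

Lemma measurable_fun_affine_comp (g : R -> R) (t : R) : continuous g ->
  measurable_fun setT (fun x => g (t * W x + B)).
Proof.
move=> cg; apply: (measurableT_comp (continuous_measurable_fun cg)).
by apply: measurable_funD => //; exact: measurable_funM.
Qed.

Let integrable_scrF (t : R) :
  P.-integrable setT (EFin \o (fun x => W x / m * sigm k (t * W x + B))).
Proof.
apply: integrable_bounded_mul; first exact: integrable_weight.
  exact/measurable_fun_affine_comp/sigm_continuous.
by move=> x; exact: sigm_norm_le1.
Qed.

Let integrable_weight_div : P.-integrable setT (EFin \o (fun x => W x / m)).
Proof.
have := integrableZr measurableT m^-1 (integrable_weight W_ge0 EW2_fin).
by apply: eq_integrable.
Qed.

(** [W / m] is the density of the size-biased law, so [scrF] averages [sigm] against a probability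
    measure and inherits its upper bound 1. *)
Let Rintegral_weight_div : \int[P]_x (W x / m) = 1.
Proof.
rewrite RintegralZr//; last exact: integrable_weight.
by rewrite -fine_expectation mulfV// gt_eqF.
Qed.

Lemma scrF_le1 (t : R) : F t <= 1.
Proof.
rewrite scrF_Rintegral -[leRHS]Rintegral_weight_div; apply: le_Rintegral => // x _.
by rewrite ler_piMr ?sigm_le1// divr_ge0// ltW.
Qed.

Lemma scrF_nondecreasing : {homo F : s t / s <= t}.
Proof.
move=> s t st; rewrite !scrF_Rintegral; apply: le_Rintegral => // x _.
rewrite ler_wpM2l ?divr_ge0 ?(ltW m_gt0)//.
by apply: sigm_nondecreasing => //; rewrite lerD2r ler_wpM2r.
Qed.

Lemma scrF_at0 : F 0 = sigm k B.
Proof.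
rewrite scrF_Rintegral.
under eq_Rintegral do rewrite mul0r add0r.
by rewrite RintegralZr// Rintegral_weight_div mul1r.
Qed.

(** The formal derivative under the integral sign; the chain rule brings the second factor [W]. *)
Let dF (t : R) : R := \int[P]_x (W x ^+ 2 / m * dsigm k (t * W x + B)).

Let is_derive_integrand (x : T) (t : R) :
  is_derive t 1 (fun t => W x / m * sigm k (t * W x + B))
    (W x ^+ 2 / m * dsigm k (t * W x + B)).
Proof.
have aff : is_derive t 1 (fun t => t * W x + B) (W x).
  have -> : (fun t => t * W x + B) = id * cst (W x) + cst B by [].
  by apply: is_derive_eq; rewrite /GRing.scale /= mulr0 mulr1 add0r addr0.
have sc := @is_derive1_comp _ (sigm k) (fun t => t * W x + B) t _ _
  (is_derive_sigm k_ge1 (t * W x + B)) aff.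
have -> : (fun t => W x / m * sigm k (t * W x + B)) =
  (W x / m) \*: (sigm k \o (fun t => t * W x + B)) by [].
apply: (is_derive_eq (is_deriveZ (W x / m) sc)).
by rewrite /GRing.scale /=; ring.
Qed.

(** The bound is free of [y], hence of [t], and integrable by the finite second moment: it dominates
    both in the differentiation and in the continuity argument. *)
Let integrand_bound (x : T) (y : R) :
  `|W x ^+ 2 / m * dsigm k y| <= W x ^+ 2 / m.
Proof.
have W2m : 0 <= W x ^+ 2 / m by rewrite divr_ge0 ?sqr_ge0// ltW.
rewrite ger0_norm; last by apply: mulr_ge0 => //; exact/ltW/dsigm_gt0.
by rewrite ler_piMr// dsigm_le1.
Qed.

Let integrable_sqr_div : P.-integrable setT (EFin \o (fun x => W x ^+ 2 / m)).
Proof.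
have := integrableZr measurableT m^-1 (integrable_sqr EW2_fin).
by apply: eq_integrable.
Qed.

Lemma scrF_derivable (t : R) : derivable F t 1 /\ F^`()%classic t = dF t.
Proof.
pose f (t : R) (x : T) := W x / m * sigm k (t * W x + B).
have FE : F = fun t => \int[P]_x f t x by apply/funext => s; exact: scrF_Rintegral.
have d1E s x : partial1of2 f s x = W x ^+ 2 / m * dsigm k (s * W x + B).
  by rewrite partial1of2E; have [_ ->] := is_derive_integrand x s.
(* Any bounded open window around [t] would do, the domination being uniform in [t]. *)
have It : `]t - 1, t + 1[%classic t by rewrite /= in_itv /= ltrBlDr ltrDl ltr01.
have intf s : `]t - 1, t + 1[%classic s -> P.-integrable setT (EFin \o f s).
  by move=> _; exact: integrable_scrF.
have derf s x : `]t - 1, t + 1[%classic s -> setT x -> derivable (f ^~ x) s 1.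
  by move=> _ _; have [] := is_derive_integrand x s.
have G0 x : 0 <= W x ^+ 2 / m by rewrite divr_ge0 ?sqr_ge0// ltW.
have G_ub s x : `]t - 1, t + 1[%classic s -> setT x ->
    `|partial1of2 f s x| <= W x ^+ 2 / m.
  by move=> _ _; rewrite d1E; exact: integrand_bound.
rewrite FE; split.
  exact: (@derivable_under_integral _ _ _ P f setT measurableT t _ _ It intf derf _ G0
  integrable_sqr_div G_ub).
rewrite (@differentiation_under_integral _ _ _ P f setT measurableT t _ _ It intf derf _ G0
  integrable_sqr_div G_ub).
by apply: eq_Rintegral => x _; rewrite d1E.
Qed.

Lemma derive1_scrF_continuous : continuous F^`()%classic.
Proof.
have -> : F^`()%classic = dF by apply/funext => t; have [] := scrF_derivable t.
move=> t.
have It : t \in `]t - 1, t + 1[%classic.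
  by rewrite inE /= in_itv /= ltrBlDr ltrDl ltr01.
apply: (@continuity_under_integral _ _ _ P
  (fun s x => W x ^+ 2 / m * dsigm k (s * W x + B)) setT measurableT (t - 1) (t + 1)
  _ _ (fun x => W x ^+ 2 / m) _ _ t It).
- move=> s _; apply: integrable_bounded_mul; first exact: integrable_sqr.
    exact/measurable_fun_affine_comp/dsigm_continuous.
  by move=> x; rewrite gtr0_norm ?dsigm_gt0// dsigm_le1.
- apply/aeW => x _ s _; apply: cvgM; first exact: cvg_cst.
  apply: continuous_cvg; first exact: dsigm_continuous.
  by apply: cvgD; [apply: cvgM; [exact: cvg_id|exact: cvg_cst]|exact: cvg_cst].
- exact: integrable_sqr_div.
- move=> s _; apply/aeW => x _.
  exact: integrand_bound.
Qed.

(** At 0 the kernel factor is the constant [dsigm k B], so the derivative is a positive multiple of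
    [E[W^2]]. *)
Lemma derive1_scrF_at0_gt0 : 0 < F^`()%classic 0.
Proof.
have [_ ->] := scrF_derivable 0; rewrite /dF.
under eq_Rintegral do rewrite mul0r add0r -mulrA.
rewrite RintegralZr//; last exact: integrable_sqr.
rewrite mulr_gt0//; first exact: second_moment_gt0.
by rewrite mulr_gt0 ?invr_gt0// dsigm_gt0.
Qed.

(** The change of variable [t = (e^beta - 1) s]. In the converse direction [s] is a value of [F],
    hence at most 1. *)
Lemma stationary_pointP (beta s : R) : 0 < beta -> 0 < s ->
  stationary_points P W q beta B s <->
  F ((expR beta - 1) * s) / ((expR beta - 1) * s) = (expR beta - 1)^-1.
Proof.
move=> beta0 s0; set g := expR beta - 1.
have g0 : 0 < g by rewrite subr_gt0 expR_gt1.
rewrite /stationary_points /= -/g; split=> [[_ ->]|e].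
  by field; rewrite !gt_eqF.
have Fs : F (g * s) = s.
  by move/(congr1 ( *%R^~ (g * s))): e; rewrite mulfVK ?gt_eqF ?mulr_gt0// mulKf ?gt_eqF.
by rewrite Fs -[X in _ <= X <= _]Fs scrF_le1 Fs ltW.
Qed.

(** [Q] describes a level set of [F t / t]. The point [s = 0] is split off because the ratio there
    is a division by zero; it is stationary exactly when [F 0 = 0]. *)
Lemma stationary_points_level (beta : R) (Q : R -> Prop) : 0 < beta ->
  (forall t, 0 < t -> F t / t = (expR beta - 1)^-1 <-> Q t) ->
  forall s, stationary_points P W q beta B s <->
    s = 0 /\ F 0 = 0 \/ 0 < s /\ Q ((expR beta - 1) * s).
Proof.
move=> beta0 FQ s.
have g0 : 0 < expR beta - 1 by rewrite subr_gt0 expR_gt1.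
have [s0|s0|->] := ltgtP s 0.
- by split=> [[/andP[]]|[[]|[]]]; rewrite ?leNgt ?s0// => ?; lra.
- rewrite stationary_pointP// FQ ?mulr_gt0//.
  by split=> [|[[]|[]//]]; [right|lra].
- rewrite /stationary_points /= mulr0 lexx ler01.
  by split=> [[_ F0]|[[_ F0]|[]//]]; [left|].
Qed.

End MeanField.

(** The map from [beta] to [1 / (e^beta - 1)] is decreasing with inverse [ln (1 + 1 / r)], so
    comparing levels amounts to comparing values of [beta] in the reverse order. *)
Lemma ltr_lnD1V (R : realType) (beta r : R) : 0 < beta -> 0 < r ->
  (beta < ln (1 + r^-1)) = (r < (expR beta - 1)^-1).
Proof.
move=> beta0 r0; have r1 : 0 < 1 + r^-1 by rewrite addr_gt0 ?invr_gt0.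
have g0 : 0 < expR beta - 1 by rewrite subr_gt0 expR_gt1.
by rewrite -ltr_expR lnK// -ltrBlDl -ltf_pV2 ?posrE ?invr_gt0// invrK.
Qed.

Lemma ltr_lnD1V_r (R : realType) (beta r : R) : 0 < beta -> 0 < r ->
  (ln (1 + r^-1) < beta) = ((expR beta - 1)^-1 < r).
Proof.
move=> beta0 r0; have r1 : 0 < 1 + r^-1 by rewrite addr_gt0 ?invr_gt0.
have g0 : 0 < expR beta - 1 by rewrite subr_gt0 expR_gt1.
by rewrite -ltr_expR lnK// -ltrBrDl -ltf_pV2 ?posrE ?invr_gt0// invrK.
Qed.

Lemma lnD1V_gt0 (R : realType) (r : R) : 0 < r -> 0 < ln (1 + r^-1).
Proof. by move=> r0; rewrite ln_gt0// ltrDl invr_gt0. Qed.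

Lemma lnD1V_decreasing (R : realType) (r s : R) : 0 < r -> r < s ->
  ln (1 + s^-1) < ln (1 + r^-1).
Proof.
move=> r0 rs; have s0 := lt_trans r0 rs.
by rewrite ltr_ln ?posrE ?addr_gt0 ?invr_gt0// ltrD2l ltf_pV2.
Qed.

(** * Phase diagrams for [B = 0] and for positive [B] *)

Theorem theorem1p9 (d : measure_display) (T : measurableType d) (R : realType)
    (P : probability T R) (W : {RV P >-> R}) (c tau : R) (q : nat)
    (W_ge0 : forall x : T, 0 <= W x)
    (EW_gt0 : (0 < 'E_P[W])%E)
    (c_gt0 : 0 < c)
    (tau_gt2 : 2 < tau)
    (W_tail : forall w : R, 1 <= w ->
       (P [set x | (w < W x)%R] <= (c * w `^ (- (tau - 1)))%:E)%E)
    (EW2_fin : ('E_P[fun x => (W x ^+ 2)%R] < +oo)%E)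
    (q_ge3 : (3 <= q)%N) :
  (unique_zero_crossing (scrF P W q 0) ->
   exists beta0 beta1 : R,
     [/\ 0 < beta0 < beta1,
         (forall beta : R, 0 < beta < beta0 ->
            stationary_points P W q beta 0 = [set 0]),
         (forall beta : R, beta0 < beta < beta1 ->
            exists s2 s3 : R, 0 < s2 < s3 /\
              stationary_points P W q beta 0 = [set 0; s2; s3])
       & (forall beta : R, beta1 < beta ->
            exists s3 : R, 0 < s3 /\
              stationary_points P W q beta 0 = [set 0; s3])])
  /\
  (forall B : R, 0 < B < ln (q%:R - 1) ->
   zero_crossing (scrF P W q B) ->
   exists beta0 beta1 : R,
     [/\ 0 < beta0 < beta1,
         (forall beta : R, 0 < beta < beta0 ->
            exists s1 : R, 0 < s1 /\
              stationary_points P W q beta B = [set s1]),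
         (forall beta : R, beta0 < beta < beta1 ->
            exists s1 s2 s3 : R, [/\ 0 < s1, s1 < s2, s2 < s3 &
              stationary_points P W q beta B = [set s1; s2; s3]])
       & (forall beta : R, beta1 < beta ->
            exists s3 : R, 0 < s3 /\
              stationary_points P W q beta B = [set s3])]).
Proof.
have q_ge2 : (2 <= q)%N by exact: ltnW.
have k_ge1 : 1 <= q%:R - 1 :> R by rewrite lerBrDr -[1 + 1]/(2%:R) ler_nat.
have g_gt0 (beta : R) : 0 < beta -> 0 < expR beta - 1.
  by move=> beta0; rewrite subr_gt0 expR_gt1.
have v_gt0 (beta : R) : 0 < beta -> 0 < (expR beta - 1)^-1.
  by move=> beta0; rewrite invr_gt0 g_gt0.
(* Solves [t = g s] for [s], as an equality of propositions so that it can be used for rewriting. *)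
have mul_eq (g s t : R) : 0 < g -> (g * s = t) = (s = t / g).
  move=> g0; apply/propext; split=> [<-|->]; first by rewrite mulrAC mulfV ?mul1r// gt_eqF.
  by rewrite mulrC divfK// gt_eqF.
have dF B t : derivable (scrF P W q B) t 1.
  by have [] := scrF_derivable B W_ge0 EW_gt0 EW2_fin q_ge2 t.
have cdF B := derive1_scrF_continuous (B := B) W_ge0 EW_gt0 EW2_fin q_ge2.
have F_le1 B t : scrF P W q B t <= 1 by exact: scrF_le1.
have F0 B : scrF P W q B 0 = sigm (q%:R - 1) B by exact: scrF_at0.
split=> [[ts [infl _]]|B /andP[B0 _] [[ts [infl _]] steep]].
- have F00 : scrF P W q 0 0 = 0 by rewrite F0 sigm0.
  have [|t _||r0 [rb [/andP[r00 r0b] levels]]] :=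
    level_sets_vanishing_at0 (@dF 0) (cdF 0) F00.
  + exact: derive1_scrF_at0_gt0.
  + exact: F_le1.
  + by exists ts.
  have rb0 := lt_trans r00 r0b.
  have stat (beta : R) := stationary_points_level (B := 0) (beta := beta) W_ge0 EW_gt0 EW2_fin q_ge2.
  (* The larger level [rb] gives the smaller threshold, since the level decreases in [beta]. *)
  exists (ln (1 + rb^-1)), (ln (1 + r0^-1)); split.
  + by rewrite lnD1V_gt0// lnD1V_decreasing.
  + move=> beta /andP[beta0]; rewrite ltr_lnD1V// => lt_b.
    have [/(_ lt_b) none _ _] := levels _ (v_gt0 _ beta0).
    apply/funext => s; apply/propext.
    (* The level set is empty, so only [s = 0] remains, by [F 0 = 0]. *)
    rewrite (stat _ (fun=> False) beta0) /=; last by move=> t t0; split=> // /none; exact.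
    by split=> [[[]//|[]//]|->]; left.
  + move=> beta /andP[b0_lt lt_b1].
    have beta0 := lt_trans (lnD1V_gt0 rb0) b0_lt; have g0 := g_gt0 _ beta0.
    have [_ + _] := levels _ (v_gt0 _ beta0).
    rewrite -ltr_lnD1V// -ltr_lnD1V_r// lt_b1 b0_lt => /(_ isT)[t2 [t3 [t20 t23 tE]]].
    exists (t2 / (expR beta - 1)), (t3 / (expR beta - 1)).
    split; first by rewrite divr_gt0// ltr_pM2r ?invr_gt0.
    apply/funext => s; apply/propext.
    rewrite (stat _ _ beta0 tE) /= F00 !mul_eq//; split.
      by move=> [[-> _]|[_ [->|->]]]; [left; left|left; right|right].
    move=> [[->|->]|->]; [by left|right; split=> //; [|by left]|right; split=> //; [|by right]].
      exact: divr_gt0.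
    by rewrite divr_gt0// (lt_trans t20).
  + move=> beta b1_lt.
    have beta0 := lt_trans (lnD1V_gt0 r00) b1_lt; have g0 := g_gt0 _ beta0.
    have [_ _] := levels _ (v_gt0 _ beta0).
    rewrite -ltr_lnD1V_r// => /(_ b1_lt)[t3 t30 tE].
    exists (t3 / (expR beta - 1)); split; first exact: divr_gt0.
    apply/funext => s; apply/propext.
    rewrite (stat _ _ beta0 tE) /= F00 !mul_eq//; split.
      by move=> [[-> _]|[_ ->]]; [left|right].
    by move=> [->|->]; [left|right; split=> //; exact: divr_gt0].
- have F0_gt0 : 0 < scrF P W q B 0 by rewrite F0; exact: sigm_gt0.
  have F0_le t : 0 <= t -> scrF P W q B 0 <= scrF P W q B t by exact: scrF_nondecreasing.
  have [t _||ra [rb [/andP[ra0 rab] levels]]] :=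
    level_sets_positive_at0 (@dF B) (cdF B) F0_gt0 F0_le.
  + exact: F_le1.
  + by exists ts => //; exact: steep.
  have rb0 := lt_trans ra0 rab.
  (* This rules out [s = 0] as a solution. *)
  have F0_neq0 : scrF P W q B 0 <> 0 by move=> e; move: F0_gt0; rewrite e ltxx.
  have stat (beta : R) := stationary_points_level (B := B) (beta := beta) W_ge0 EW_gt0 EW2_fin q_ge2.
  (* Serves both extreme ranges of [beta], where a single crossing is left. *)
  have single (beta t1 : R) : 0 < beta -> 0 < t1 ->
      (forall t, 0 < t -> scrF P W q B t / t = (expR beta - 1)^-1 <-> t = t1) ->
      exists s1 : R, 0 < s1 /\ stationary_points P W q beta B = [set s1].
    move=> beta0 t10 tE; have g0 := g_gt0 _ beta0.
    exists (t1 / (expR beta - 1)); split; first exact: divr_gt0.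
    apply/funext => s; apply/propext.
    rewrite (stat _ _ beta0 tE) /= mul_eq//; split=> [[[_ //]|[_ ->//]]|->].
    by right; split=> //; exact: divr_gt0.
  (* The local maximum of the ratio gives the lower threshold, the local minimum the upper one. *)
  exists (ln (1 + rb^-1)), (ln (1 + ra^-1)); split.
  + by rewrite lnD1V_gt0// lnD1V_decreasing.
  + move=> beta /andP[beta0]; rewrite ltr_lnD1V// => lt_b.
    have [/(_ lt_b)[t1 t10 tE] _ _] := levels _ (v_gt0 _ beta0).
    exact: single tE.
  + move=> beta /andP[b0_lt lt_b1].
    have beta0 := lt_trans (lnD1V_gt0 rb0) b0_lt; have g0 := g_gt0 _ beta0.
    have [_ + _] := levels _ (v_gt0 _ beta0).
    rewrite -ltr_lnD1V// -ltr_lnD1V_r// lt_b1 b0_lt.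
    move=> /(_ isT)[t1 [t2 [t3 [t10 t12 t23 tE]]]].
    have t20 := lt_trans t10 t12; have t30 := lt_trans t20 t23.
    exists (t1 / (expR beta - 1)), (t2 / (expR beta - 1)), (t3 / (expR beta - 1)).
    split; rewrite ?ltr_pM2r ?invr_gt0//; first exact: divr_gt0.
    apply/funext => s; apply/propext.
    rewrite (stat _ _ beta0 tE) /= !mul_eq//; split.
      by move=> [[_ //]|[_ [->|->|->]]]; [left; left|left; right|right].
    move=> sE; right; move: sE.
    by move=> [[->|->]|->]; split; rewrite ?divr_gt0//;
      [constructor 1|constructor 2|constructor 3].
  + move=> beta b1_lt.
    have beta0 := lt_trans (lnD1V_gt0 ra0) b1_lt.
    have [_ _] := levels _ (v_gt0 _ beta0).
    by rewrite -ltr_lnD1V_r// => /(_ b1_lt)[t3 t30 tE]; exact: single tE.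
Qed.
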